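(* Let $(w^n)_{n\in\mathbb{N}}$ be a sequence generated by the Iterative Kernel Thresholding Algorithm (IKTA), converging to $\bar w\in H$. If $$\max_{g\notin\operatorname{supp}(\bar w)}\ \frac{1}{\lambda}\Vert X_g^*(X\bar w-y)\Vert_{H_g}<1,$$ then there exists $N\in\mathbb{N}$ such that $$(\forall n\ge N)\quad \operatorname{supp}(w^n)=\operatorname{supp}(\bar w).$$
   Context: Setting. Let $d,m,G\ge 1$ be integers, $x_1,\dots,x_m\in\mathbb{R}^d$, $y=(y_1,\dots,y_m)\in\mathbb{R}^m$, and $\lambda>0$. Let $H_1,\dots,H_G$ be separable real Hilbert spaces (possibly infinite-dimensional), let $\Phi_g:\mathbb{R}^d\to H_g$ be a map for each $g\in\{1,\dots,G\}$, and let $H=H_1\times\dots\times H_G$ be the product Hilbert space, whose elements are written $w=(w_1,\dots,w_G)$. Convergence in $H$ is in norm. For each $g$, define $X_g:H_g\to\mathbb{R}^m$ by $X_gw_g=(\langle\Phi_g(x_i),w_g\rangle_{H_g})_{i=1}^m$, with adjoint $X_g^*:\mathbb{R}^m\to H_g$, and $K_g:=X_gX_g^*\in\mathbb{R}^{m\times m}$. Let $X:H\to\mathbb{R}^m$, $Xw=\sum_{g=1}^GX_gw_g$. Elements $\alpha\in\mathbb{R}^{m\times G}$ are identified with $(\alpha_1,\dots,\alpha_G)$, $\alpha_g\in\mathbb{R}^m$. Let $K=[K_1,\dots,K_G]$, so that $K\alpha=\sum_{g=1}^GK_g\alpha_g\in\mathbb{R}^m$, and let $\Vert K\Vert$ be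 its operator norm (with $2\Vert K\Vert^{-1}=+\infty$ if $K=0$). For $\mu>0$, $g\in\{1,\dots,G\}$ and $\alpha_g\in\mathbb{R}^m$, define the thresholding operator $\widehat{\mathcal{G}}_{\mu,g}(\alpha_g):=0$ if $\Vert X_g^*\alpha_g\Vert_{H_g}\le\mu$, and $\widehat{\mathcal{G}}_{\mu,g}(\alpha_g):=\big(1-\frac{\mu}{\Vert X_g^*\alpha_g\Vert_{H_g}}\big)\alpha_g$ otherwise. Algorithm (IKTA). Given $\alpha^0\in\mathbb{R}^{m\times G}$ and $\tau\in\,]0,2\Vert K\Vert^{-1}[$, for all $n\in\mathbb{N}$ and $g\in\{1,\dots,G\}$, $$\alpha_g^{n+1}=\widehat{\mathcal{G}}_{\lambda\tau,g}\big(\alpha_g^n-\tau(K\alpha^n-y)\big),\qquad w_g^{n+1}=X_g^*\alpha_g^{n+1},$$ with $w_g^0=X_g^*\alpha_g^0$. The (group) support of $w\in H$ is $\operatorname{supp}(w):=\{g\in\{1,\dots,G\}:w_g\ne0\}$. The maximum is over $g\in\{1,\dots,G\}\setminus\operatorname{supp}(\bar w)$; the condition is vacuously satisfied if this set is empty. *)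

(* Defs.v *)
From HB Require Import structures.
From mathcomp Require Import all_boot all_order all_algebra.
From mathcomp Require Import all_classical all_reals.
From mathcomp Require Import ereal topology normedtype sequences.

Set Implicit Arguments.
Unset Strict Implicit.
Unset Printing Implicit Defensive.

Import Order.TTheory GRing.Theory Num.Theory.
Import numFieldNormedType.Exports.

Local Open Scope classical_set_scope.
Local Open Scope ring_scope.

HB.mixin Record hasInner (R : realType) H & NormedModule R H := {
  inner : {dot H for idfun} ;
  innerE : forall v : H, inner v v = `|v| ^+ 2
}.

#[short(type="hilbertType")]
HB.structure Definition Hilbert (R : realType) :=
  {H of CompleteNormedModule R H & hasInner R H}.

Definition separable (T : topologicalType) :=
  exists2 A : set T, countable A & dense A.

Section Euclidean.
Variable R : realType.

(* The library norm on matrices is the sup norm; the Euclidean structure of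
   R^m = 'cV_m and R^(m x n) = 'M_(m, n) is the following one. *)
Definition mxdot m n (A B : 'M[R]_(m, n)) : R := \sum_i \sum_j A i j * B i j.

Definition mxnorm2 m n (A : 'M[R]_(m, n)) : R := Num.sqrt (mxdot A A).

Definition opnorm2 m n p q (f : 'M[R]_(m, n) -> 'M[R]_(p, q)) : \bar R :=
  ereal_sup [set (mxnorm2 (f A))%:E | A in [set A | mxnorm2 A <= 1]].

(* The Hilbert adjoint of A : U -> R^m, by its defining property; [xget 0]
   selects the unique vector that has it (see [XadjP] and [inner_inj]). *)
Definition adjoint (U : hilbertType R) m (A : U -> 'cV[R]_m) (a : 'cV[R]_m)
    : U :=
  xget 0 [set u | forall v, inner u v = mxdot a (A v)].

Lemma inner_inj (U : hilbertType R) (u v : U) :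
  (forall w, inner u w = inner v w) -> u = v.
Proof.
move=> uv; apply/eqP; rewrite -subr_eq0 -normr_eq0 -sqrf_eq0 -innerE.
by rewrite linearBl /= uv subrr.
Qed.

End Euclidean.

Section Product.
Variables (R : realType) (G : nat) (H : 'I_G -> hilbertType R).
Implicit Types u v w : forall g, H g.

Definition prod_inner u v : R := \sum_g inner (u g) (v g).

Definition prod_norm w : R := Num.sqrt (prod_inner w w).

Definition supp w : {set 'I_G} := [set g | w g != 0].

End Product.

Section Kernels.
Variables (R : realType) (d m G : nat) (H : 'I_G -> hilbertType R).
Variables (x : 'I_m -> 'rV[R]_d) (Phi : forall g, 'rV[R]_d -> H g).

Definition Xg (g : 'I_G) (w : H g) : 'cV[R]_m :=
  \col_i inner (Phi g (x i)) w.

Definition Xadj (g : 'I_G) : 'cV[R]_m -> H g := adjoint (@Xg g).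

Definition Xop (w : forall g, H g) : 'cV[R]_m := \sum_g Xg (w g).

(* The matrix, in the canonical basis of R^m, of the operator X_g X_g^*. *)
Definition Kg (g : 'I_G) : 'M[R]_m :=
  \matrix_(i, j) Xg (Xadj g (delta_mx j 0)) i 0.

(* K alpha, where alpha_g is the g-th column of alpha. *)
Definition Kop (alpha : 'M[R]_(m, G)) : 'cV[R]_m :=
  \sum_g Kg g *m col g alpha.

Definition thresh (mu : R) (g : 'I_G) (a : 'cV[R]_m) : 'cV[R]_m :=
  if `|Xadj g a| <= mu then 0 else (1 - mu / `|Xadj g a|) *: a.

Definition IKTA (y : 'cV[R]_m) (lam tau : R)
    (alpha : nat -> 'M[R]_(m, G)) (w : nat -> forall g, H g) : Prop :=
  (forall n g, col g (alpha n.+1) =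
     thresh (lam * tau) g (col g (alpha n) - tau *: (Kop (alpha n) - y))) /\
  (forall n g, w n g = Xadj g (col g (alpha n))).

Lemma XadjE g a : Xadj g a = \sum_i a i 0 *: Phi g (x i).
Proof.
have P v : inner (\sum_i a i 0 *: Phi g (x i)) v = mxdot a (Xg v).
  rewrite linear_sumlz; apply: eq_bigr => i _.
  by rewrite big_ord1 mxE linearZl_LR.
rewrite /Xadj /adjoint; apply: xget_unique => // u Pu.
by apply: inner_inj => v; rewrite Pu P.
Qed.

Lemma XadjP g a v : inner (Xadj g a) v = mxdot a (Xg v).
Proof.
rewrite XadjE linear_sumlz; apply: eq_bigr => i _.
by rewrite big_ord1 mxE linearZl_LR.
Qed.

Lemma KgE g a : Kg g *m a = Xg (Xadj g a).
Proof.
apply/colP => i; rewrite !mxE XadjE linear_sumr; apply: eq_bigr => j _.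
rewrite !mxE XadjE (bigD1 j) //= big1 ?addr0; last first.
  by move=> k /negPf kj; rewrite mxE kj scale0r.
by rewrite mxE !eqxx scale1r linearZr_LR /= mulrC.
Qed.

End Kernels.

(* Main.v *)
(* X_g^* maps the argument alpha^n_g - tau (K alpha^n - y) of the thresholding to
   the forward step w^n_g - tau X_g^* (X w^n - y), which converges to the one at
   wbar.  For g outside supp(wbar) the limit has norm
   tau ||X_g^* (X wbar - y)|| < lam tau, so the thresholding eventually returns
   0.  For g in supp(wbar), w^n_g converges to a nonzero vector. *)
Require Import Defs.
From HB Require Import structures.
From mathcomp Require Import all_boot all_order all_algebra.
From mathcomp Require Import all_classical all_reals.
From mathcomp Require Import ereal topology normedtype sequences.
From mathcomp Require Import ring.

Set Implicit Arguments.
Unset Strict Implicit.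
Unset Printing Implicit Defensive.

Import Order.TTheory GRing.Theory Num.Theory.
Import numFieldNormedType.Exports.

Local Open Scope classical_set_scope.
Local Open Scope ring_scope.

Lemma prod_inner_ge0 (R : realType) (G : nat) (H : 'I_G -> hilbertType R)
    (u : forall g, H g) : 0 <= prod_inner u u.
Proof. by apply: sumr_ge0 => g _; rewrite innerE exprn_ge0. Qed.

Lemma norm_le_prod_norm (R : realType) (G : nat) (H : 'I_G -> hilbertType R)
    (u : forall g, H g) (g : 'I_G) : `|u g| <= prod_norm u.
Proof.
rewrite -[leLHS]ger0_norm // -sqrtr_sqr ler_sqrt ?prod_inner_ge0 //.
rewrite /prod_inner (bigD1 g) //= innerE lerDl.
by apply: sumr_ge0 => h _; rewrite innerE exprn_ge0.
Qed.

(** Each component norm is squeezed between 0 and the product norm. *)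
Lemma prod_norm_cvg (R : realType) (G : nat) (H : 'I_G -> hilbertType R)
    (w : nat -> forall g, H g) (wbar : forall g, H g) (g : 'I_G) :
  prod_norm (fun g => w n g - wbar g) @[n --> \oo] --> (0 : R) ->
  w n g @[n --> \oo] --> wbar g.
Proof.
move=> w_cvg; apply/subr_cvg0; apply: norm_cvg0.
apply: (squeeze_cvgr _ (cvg_cst 0) w_cvg).
near=> n; rewrite normr_ge0 /=.
exact: (norm_le_prod_norm (fun g => w n g - wbar g)).
Unshelve. all: by end_near. Qed.

Section InnerContinuity.
Variables (R : realType) (U : hilbertType R).

(** Polarization reduces the continuity of [inner] to that of the norm. *)
Lemma inner_polar (u v : U) :
  inner u v = (`|u + v| ^+ 2 - `|u| ^+ 2 - `|v| ^+ 2) / 2.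
Proof.
(* Symmetry comes from the hermitian form having trivial conjugation and sign $(-1)^0$. *)
rewrite -!innerE linearDl /= !linearDr /= (hermC _ v u) /= expr0 mul1r.
by field.
Qed.

Lemma inner_cvgr (u : U) (v : nat -> U) (l : U) :
  v n @[n --> \oo] --> l -> inner u (v n) @[n --> \oo] --> inner u l.
Proof.
move=> v_cvg.
have sq_cvg (f : nat -> U) a : f n @[n --> \oo] --> a ->
    `|f n| ^+ 2 @[n --> \oo] --> `|a| ^+ 2.
  by move=> /cvg_norm f_cvg; rewrite expr2; apply: cvgM.
rewrite inner_polar; under eq_fun do rewrite inner_polar.
apply: cvgMr_tmp; apply: cvgB; last exact: sq_cvg.
by apply: cvgB; [apply: sq_cvg; apply: cvgD => //|]; apply: cvg_cst.
Qed.

End InnerContinuity.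

Section Kernels.
Variables (R : realType) (d m G : nat) (H : 'I_G -> hilbertType R).
Variables (x : 'I_m -> 'rV[R]_d) (Phi : forall g, 'rV[R]_d -> H g).

Lemma XadjB g a b : Xadj x Phi g (a - b) = Xadj x Phi g a - Xadj x Phi g b.
Proof.
by rewrite !XadjE -sumrB; apply: eq_bigr => i _; rewrite !mxE scalerBl.
Qed.

Lemma XadjZ g c a : Xadj x Phi g (c *: a) = c *: Xadj x Phi g a.
Proof.
by rewrite !XadjE scaler_sumr; apply: eq_bigr => i _; rewrite mxE scalerA.
Qed.

Lemma Xadj0 g : Xadj x Phi g 0 = 0.
Proof. by rewrite -(subrr 0) XadjB subrr. Qed.

(** By [XadjE], both sides are combinations of the fixed vectors [Phi g (x i)]; their scalar
    coefficients are finite sums of inner products, each continuous in one component of $w$. *)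
Lemma Xadj_Xop_cvg g y (w : nat -> forall g, H g) (wbar : forall g, H g) :
    (forall h, w n h @[n --> \oo] --> wbar h) ->
  Xadj x Phi g (Xop x Phi (w n) - y) @[n --> \oo] -->
  Xadj x Phi g (Xop x Phi wbar - y).
Proof.
move=> w_cvg; rewrite XadjE; under eq_fun do rewrite XadjE.
apply: cvg_big => [|i _]; first exact: add_continuous.
apply: cvgZr_tmp; rewrite !mxE; under eq_fun do rewrite !mxE.
apply: cvgB; last exact: cvg_cst.
rewrite summxE; under eq_fun do rewrite summxE.
apply: cvg_big => [|h _]; first exact: add_continuous.
by rewrite mxE; under eq_fun do rewrite mxE; apply: inner_cvgr.
Qed.

End Kernels.

Theorem theorem1 (R : realType) (d m G : nat)
    (d_gt0 : (0 < d)%N) (m_gt0 : (0 < m)%N) (G_gt0 : (0 < G)%N)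
    (x : 'I_m -> 'rV[R]_d) (y : 'cV[R]_m) (lam : R) (lam_gt0 : 0 < lam)
    (H : 'I_G -> hilbertType R) (H_sep : forall g, separable (H g))
    (Phi : forall g, 'rV[R]_d -> H g)
    (tau : R) (tau_gt0 : 0 < tau)
    (tau_lt : (tau%:E < 2%:E * (opnorm2 (Kop x Phi))^-1)%E)
    (alpha : nat -> 'M[R]_(m, G)) (w : nat -> forall g, H g)
    (w_ikta : IKTA x Phi y lam tau alpha w)
    (wbar : forall g, H g)
    (w_cvg : prod_norm (fun g => w n g - wbar g) @[n --> \oo] --> (0 : R))
    (max_lt1 :
      \big[Num.max/0]_(g < G | g \notin supp wbar)
        (lam^-1 * `|Xadj x Phi g (Xop x Phi wbar - y)|) < 1) :
  exists N : nat, forall n : nat, (N <= n)%N -> supp (w n) = supp wbar.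
Proof.
case: w_ikta => alphaS wE.
(* This identity lets the iteration be read on [w] alone. *)
have KE n : Kop x Phi (alpha n) = Xop x Phi (w n).
  by apply: eq_bigr => h _; rewrite KgE wE.
have w_cvgg g : w n g @[n --> \oo] --> wbar g by exact: prod_norm_cvg.
suff [N _ Nsupp] : \forall n \near \oo, forall g,
    (w n g != 0) = (wbar g != 0).
  by exists N => n /Nsupp suppE; apply/setP => g; rewrite !inE.
(* There are finitely many groups, so thresholds found group by group yield a common one. *)
apply: filter_forall => g.
have [wbar0|wbar_neq0] := eqVneq (wbar g) 0; last first.
  near=> n; near: n; exact: cvgr_neq0 (w_cvgg g) wbar_neq0.
set r := Xadj x Phi g (Xop x Phi wbar - y).
have r_lt : `|wbar g - tau *: r| < lam * tau.
  rewrite wbar0 sub0r normrN normrZ gtr0_norm // mulrC ltr_pM2r //.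
  (* The discarded component is the trivial bound $0 < 1$ on the default value of the maximum. *)
  case/bigmax_ltP: max_lt1 => _ /(_ g).
  by rewrite inE wbar0 eqxx ltr_pdivrMl ?mulr1 //; apply.
have step_cvg : w n g - tau *: Xadj x Phi g (Xop x Phi (w n) - y)
    @[n --> \oo] --> wbar g - tau *: r.
  apply: cvgB; first exact: w_cvgg.
  by apply: cvgZl_tmp; apply: Xadj_Xop_cvg.
(* The strict bound on the limit gives the large inequality tested by [thresh]. *)
have [N _ Nstep] := cvgr_norm_le _ step_cvg _ r_lt.
(* The shift by one arises because the forward step at [n] determines [w n.+1]. *)
exists N.+1 => // -[//|n] Nn /=; apply/negbTE; rewrite negbK.
rewrite wE alphaS /thresh XadjB XadjZ KE -wE.
by rewrite Nstep //= Xadj0.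
Unshelve. all: by end_near. Qed.
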